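(* Let $(g,h)$ and $(g',h')$ be constraint map-germs $(\mathbb R^n,0)\to\mathbb R^q\times\mathbb R^r$ with non-empty feasible set-germs which are $\mathcal K[G]$-equivalent. Then for each of the constraint qualifications $X\in\{\mathrm{LICQ},\mathrm{MFCQ},\mathrm{ACQ},\mathrm{GCQ}\}$, $(g,h)$ satisfies $X$ if and only if $(g',h')$ satisfies $X$.
   Context: A constraint map-germ is a smooth map-germ $(g,h):(\mathbb R^n,0)\to\mathbb R^q\times\mathbb R^r$ with $h(0)=0$; its feasible set-germ $M(g,h)$ is the germ at $0$ of $\{x: g_i(x)\le0\ \forall i,\ h_j(x)=0\ \forall j\}$. It is non-empty iff $g_j(0)\le0$ for all $j$. Let $I=\{j: g_j(0)=0\}$ and $g_I=(g_j)_{j\in I}$. - LICQ: the Jacobian of $(g_I,h)$ at $0$ has full rank $|I|+r$. - MFCQ: $dh_0$ has rank $r$ and there is $d\in\mathbb R^n$ with $dg_{j,0}(d)<0$ for all $j\in I$ and $dh_0(d)=0$. - Tangent cone: $C^+(g,h)=\{d\in\mathbb R^n:\exists x_m\in M(g,h),\ x_m\to0,\ \exists t_m>0,\ t_mx_m\to d\}$. Linearized cone: $L^+(g,h)=\{d\in\mathbb R^n: dg_{j,0}(d)\le0\ \forall j\in I,\ dh_0(d)=0\}$. - ACQ: $C^+(g,h)=L^+(g,h)$. - GCQ: $C^+(g,h)^\circ=L^+(g,h)^\circ$, where $X^\circ=\{v\in\mathbb R^n: v\cdot d\le0\ \forall d\in X\}$. $\mathcal K[G]$-equivalence: $(g,h)$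 and $(g',h')$ are $\mathcal K[G]$-equivalent if there are a diffeomorphism-germ $\Phi:(\mathbb R^n,0)\to(\mathbb R^n,0)$ and smooth germs at $0\in\mathbb R^n$ of matrix-valued maps $C$ ($q\times q$, each $C(x)$ a product of a diagonal matrix with positive diagonal entries and a permutation matrix), $B$ ($q\times r$, arbitrary), $A$ ($r\times r$, each $A(x)$ invertible) with $g(x)=C(x)g'(\Phi^{-1}(x))+B(x)h'(\Phi^{-1}(x))$ and $h(x)=A(x)h'(\Phi^{-1}(x))$. *)

(* Defs.v *)
From HB Require Import structures.
From mathcomp Require Import all_boot all_order all_algebra all_fingroup.
From mathcomp Require Import all_classical all_reals all_analysis.

Set Implicit Arguments.
Unset Strict Implicit.
Unset Printing Implicit Defensive.

Import Order.TTheory GRing.Theory Num.Theory.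
Import numFieldNormedType.Exports.

Local Open Scope classical_set_scope.
Local Open Scope ring_scope.

(* A map-germ at 0 is given by a globally defined representative; only its
   restriction to some neighbourhood of 0 matters, and every condition on x
   in a germ is required for all x near 0. Vectors of R^n are row vectors. *)

Fixpoint iter_derive (R : realType) (V W : normedModType R) (vs : seq V)
    (f : V -> W) : V -> W :=
  if vs is v :: vs' then 'D_v (iter_derive vs' f) else f.

(* C^oo on a neighbourhood of p: f can be differentiated any number of times,
   in any directions, there. *)
Definition smooth_near (R : realType) (V W : normedModType R) (f : V -> W)
    (p : V) : Prop :=
  \forall x \near p, forall vs : seq V, differentiable (iter_derive vs f) x.

Section ConstraintGerms.
Variables (R : realType) (n q r : nat).
Implicit Types (g : 'rV[R]_n -> 'rV[R]_q) (h : 'rV[R]_n -> 'rV[R]_r).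

Definition constraint_germ g h : Prop :=
  [/\ smooth_near g 0, smooth_near h 0 & h 0 = 0].

Definition component g (j : 'I_q) : 'rV[R]_n -> R := fun x => g x ord0 j.

Definition feasible g h : set 'rV[R]_n :=
  [set x | (forall j, component g j x <= 0) /\ h x = 0].

(* The germ at 0 of a set is non-empty iff the set meets every neighbourhood
   of 0. *)
Definition nonempty_germ (X : set 'rV[R]_n) : Prop := closure X 0.

Definition active g : {set 'I_q} := [set j | component g j 0 == 0]%SET.

Definition active_part g : 'rV[R]_n -> 'rV[R]_#|active g| :=
  fun x => \row_(k < #|active g|) component g (enum_val k) x.

(* The library's Jacobian of a map R^n -> R^m acts on row vectors from the
   right, so it is the n x m transpose of the usual one. *)
Definition LICQ g h : Prop :=
  \rank ('J (fun x => row_mx (active_part g x) (h x)) 0) = (#|active g| + r)%N.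

Definition MFCQ g h : Prop :=
  \rank ('J h 0) = r /\
  exists d : 'rV[R]_n,
    (forall j, j \in active g -> 'd (component g j) (0 : 'rV[R]_n) d < 0) /\
    'd h (0 : 'rV[R]_n) d = 0.

Definition tangent_cone g h : set 'rV[R]_n :=
  [set d | exists x : nat -> 'rV[R]_n, exists t : nat -> R,
    [/\ forall m, feasible g h (x m),
        x m @[m --> \oo] --> (0 : 'rV[R]_n),
        forall m, 0 < t m &
        t m *: x m @[m --> \oo] --> d]].

Definition linearized_cone g h : set 'rV[R]_n :=
  [set d | (forall j, j \in active g ->
              'd (component g j) (0 : 'rV[R]_n) d <= 0) /\
           'd h (0 : 'rV[R]_n) d = 0].

Definition polar (X : set 'rV[R]_n) : set 'rV[R]_n :=
  [set v | forall d, X d -> \sum_(i < n) v ord0 i * d ord0 i <= 0].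

Definition ACQ g h : Prop := tangent_cone g h = linearized_cone g h.

Definition GCQ g h : Prop :=
  polar (tangent_cone g h) = polar (linearized_cone g h).

(* Phi is a diffeomorphism-germ of (R^n, 0) and Psi is its inverse. *)
Definition diffeo_germ (Phi Psi : 'rV[R]_n -> 'rV[R]_n) : Prop :=
  [/\ smooth_near Phi 0, smooth_near Psi 0, Phi 0 = 0, Psi 0 = 0 &
      \forall x \near (0 : 'rV[R]_n), Phi (Psi x) = x /\ Psi (Phi x) = x].

Definition pos_monomial (M : 'M[R]_q) : Prop :=
  exists (d : 'rV[R]_q) (s : 'S_q),
    (forall j, 0 < d ord0 j) /\ M = diag_mx d *m perm_mx s.

Definition KG_equivalent g h g' h' : Prop :=
  exists Phi Psi : 'rV[R]_n -> 'rV[R]_n,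
  exists C : 'rV[R]_n -> 'M[R]_q,
  exists B : 'rV[R]_n -> 'M[R]_(q, r),
  exists A : 'rV[R]_n -> 'M[R]_r,
    [/\ diffeo_germ Phi Psi,
        [/\ smooth_near C 0, smooth_near B 0 & smooth_near A 0],
        \forall x \near (0 : 'rV[R]_n), pos_monomial (C x) /\ A x \in unitmx &
        \forall x \near (0 : 'rV[R]_n),
          (g x)^T = C x *m (g' (Psi x))^T + B x *m (h' (Psi x))^T /\
          (h x)^T = A x *m (h' (Psi x))^T].

End ConstraintGerms.

(* Main.v *)
(* Let P be the differential at 0 of the inverse diffeomorphism Psi. Because the
   active components of g' and all components of h' vanish at 0, the derivatives
   of C, B and A do not contribute to the first order: on active indices
   dg_j = c_j dg'_(s j) P + b_j dh' P with c_j > 0, and dh = A(0) dh' P. Hence P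
   maps the linearized cone of (g, h) onto that of (g', h'), also with strict
   inequalities, and surjectivity of (dg_I, dh) is preserved. Psi maps feasible
   points to feasible points, so P also maps the tangent cone onto the tangent
   cone, and polars are transported by the inverse transpose of P. *)

From HB Require Import structures.
Require Import Defs.
From mathcomp Require Import all_boot all_order all_algebra all_fingroup.
From mathcomp Require Import all_classical all_reals all_analysis.

Set Implicit Arguments.
Unset Strict Implicit.
Unset Printing Implicit Defensive.

Import Order.TTheory GRing.Theory Num.Theory.
Import numFieldNormedType.Exports.

Local Open Scope classical_set_scope.
Local Open Scope ring_scope.

(** * Differential calculus at a point *)

Section Differentials.
Context {R : realType}.

Lemma smooth_near_differentiable (V W : normedModType R) (f : V -> W) (p : V) :
  smooth_near f p -> differentiable f p.
Proof. by move=> /nbhs_singleton /(_ [::]). Qed.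

Lemma diff_near_eq (V W : normedModType R) (f1 f2 : V -> W) (p v : V) :
  differentiable f1 p -> differentiable f2 p ->
  (\forall x \near p, f1 x = f2 x) -> 'd f1 p v = 'd f2 p v.
Proof.
move=> df1 df2 eqf; rewrite -!deriveE //.
exact: near_eq_derive.
Qed.

Lemma differentiable_entry (V : normedModType R) m n (f : V -> 'M[R]_(m, n)) p
    i j :
  differentiable f p -> differentiable (fun x => f x i j) p.
Proof.
move=> df.
apply: (differentiable_comp (g := fun N : 'M[R]_(m, n) => N i j) df).
exact: differentiable_coord.
Qed.

Lemma diff_entry (V : normedModType R) m n (f : V -> 'M[R]_(m, n)) p v i j :
  differentiable f p -> 'd (fun x => f x i j) p v = 'd f p v i j.
Proof.
move=> df.
have lin : linear (fun N : 'M[R]_(m, n) => N i j : R).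
  by move=> a x y; rewrite !mxE.
pose cM := GRing.isLinear.Build _ _ _ _ _ lin.
pose c : {linear 'M[R]_(m, n) -> R} := HB.pack (fun N : 'M[R]_(m, n) => N i j : R) cM.
rewrite [LHS](_ : _ = 'd (c \o f) p v) // diff_comp //.
  by rewrite diff_lin //; exact: coord_continuous.
by apply: linear_differentiable; exact: coord_continuous.
Qed.

Lemma differentiable_rV (V : normedModType R) n (f : V -> 'rV[R]_n) p :
  (forall j, differentiable (fun x => f x ord0 j) p) -> differentiable f p.
Proof.
move=> df.
rewrite (_ : f = \sum_(j < n) (fun x => f x ord0 j *: delta_mx 0 j)).
  by apply: differentiable_sum => j; apply: differentiableZl.
apply/funext => x; rewrite fct_sumE; exact: row_sum_delta.
Qed.

Lemma differentiable_sum_mul (V : normedModType R) k (a u : 'I_k -> V -> R) p :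
  (forall l, differentiable (a l) p) -> (forall l, differentiable (u l) p) ->
  differentiable (fun x => \sum_l a l x * u l x) p.
Proof.
move=> da du.
rewrite (_ : (fun x => _) = \sum_l (fun x => a l x * u l x)).
  by apply: differentiable_sum => l; exact: differentiableM.
by apply/funext => x; rewrite fct_sumE.
Qed.

(** Leibniz rule: the term containing the derivative of [a] carries the factor [u p = 0]. This is
    how the derivatives of [C], [B] and [A] drop out. *)
Lemma diff_mul0 (V : normedModType R) (a u : V -> R) p v :
  differentiable a p -> differentiable u p -> u p = 0 ->
  'd (fun x => a x * u x) p v = a p * 'd u p v.
Proof.
move=> da du u0; rewrite -deriveE; last exact: differentiableM.
rewrite deriveM; [|exact: diff_derivable..].
by rewrite u0 scale0r addr0 deriveE.
Qed.

Lemma diff_sum_mul0 (V : normedModType R) k (a u : 'I_k -> V -> R) p v :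
  (forall l, differentiable (a l) p) -> (forall l, differentiable (u l) p) ->
  (forall l, u l p = 0) ->
  'd (fun x => \sum_l a l x * u l x) p v = \sum_l a l p * 'd (u l) p v.
Proof.
move=> da du u0; rewrite -deriveE; last exact: differentiable_sum_mul.
rewrite (_ : (fun x => _) = \sum_l (fun x => a l x * u l x)); last first.
  by apply/funext => x; rewrite fct_sumE.
rewrite derive_sum => [|l]; last first.
  by apply: derivableM; exact: diff_derivable.
apply: eq_bigr => l _; rewrite deriveE; last exact: differentiableM.
exact: diff_mul0.
Qed.

(** The Jacobian acts on row vectors from the right, so full column rank says that its row space is
    everything. Rank conditions thus become solvability statements. *)
Lemma rank_jacobianP n m (f : 'rV[R]_n -> 'rV[R]_m) p :
  \rank ('J f p) = m <-> forall w, exists v, 'd f p v = w.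
Proof.
split=> [/eqP rkf w|surjf].
  have := submx_full w rkf => /submxP[v ->]; exists v.
  by rewrite /jacobian mul_rV_lin1.
apply/eqP; rewrite -/(row_full _) -sub1mx; apply/row_subP => i.
by have [v <-] := surjf (row i 1%:M); rewrite -mul_rV_lin1 submxMl.
Qed.

(** Chain rule applied to [f' \o f], which has the germ of the identity at [p]. *)
Lemma diff_cancel (V W : normedModType R) (f : V -> W) (f' : W -> V) p :
  differentiable f p -> differentiable f' (f p) ->
  (\forall x \near p, f' (f x) = x) -> cancel ('d f p) ('d f' (f p)).
Proof.
move=> df df' ff' v.
have did : is_diff p (@id V) id by exact: is_diff_id.
rewrite -[LHS]/(('d f' (f p) \o 'd f p) v) -diff_comp //.
rewrite (diff_near_eq (f2 := id)) ?diff_val //; exact: differentiable_comp.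
Qed.

End Differentials.

(** Split [F] into its differential and a remainder [e] with [e x = o(x)]. The scaled points
    [t m *: x m] converge, hence are eventually bounded, so [t m *: e (x m)] tends to 0. *)
Lemma scaled_cvg_image (R : realType) (V W : normedModType R) (F : V -> W)
    (x : nat -> V) (t : nat -> R) (d : V) :
  differentiable F 0 -> F 0 = 0 -> x m @[m --> \oo] --> (0 : V) ->
  t m *: x m @[m --> \oo] --> d ->
  t m *: F (x m) @[m --> \oo] --> 'd F 0 d.
Proof.
move=> dF F0 x0 txd.
pose e x := F x - 'd F 0 x.
have eo : forall eps, 0 < eps -> \forall z \near (0 : V), `|e z| <= eps * `|z|.
  have /diff_locallyP[_ /eqaddoP eqF] := dF.
  move=> eps eps0; have := eqF _ eps0; apply: filterS => z.
  rewrite !fctE /= addr0 F0 add0r; exact.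
have -> : (fun m => t m *: F (x m)) =
    (fun m => 'd F 0 (t m *: x m) + t m *: e (x m)).
  by apply/funext => m; rewrite linearZ -scalerDr addrC subrK.
rewrite -[X in _ --> X]addr0; apply: cvgD.
  apply: (@cvg_comp _ _ _ (fun m => t m *: x m) ('d F 0) _ (nbhs d)) => //.
  exact: diff_continuous.
apply/cvgr0Pnorm_le => eps eps0.
have K0 : 0 < `|d| + 1 by rewrite ltr_pwDr.
have bnd : \forall m \near \oo, `|t m *: x m| <= `|d| + 1.
  have /cvgrPdist_le/(_ _ ltr01) := txd; apply: filterS => m dm.
  rewrite -lerBlDl (le_trans (lerB_dist _ _)) // distrC; exact: dm.
(* The tolerance is [eps] divided by the bound on the norm of [t m *: x m], so that their product is
   [eps]. *)
have := x0 _ (eo _ (divr_gt0 eps0 K0)).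
apply: filterS2 bnd => m bndm em.
rewrite normrZ (le_trans (ler_wpM2l (normr_ge0 _) em)) //.
rewrite mulrCA -normrZ -[leRHS](divfK (lt0r_neq0 K0)).
by rewrite ler_pM2l // divr_gt0.
Qed.

(** * Linear algebra of the first-order data *)

Lemma mulmx_unit_inj (R : realType) m n (A : 'M[R]_n) :
  A \in unitmx -> injective (fun X : 'M[R]_(m, n) => X *m A).
Proof. by move=> uA; exact: can_inj (mulmxK uA). Qed.

Section LinearlyRelated.
Context {R : realType} {n q r : nat}.

(** In the application [G], [H] are differentials at 0, [M] is the Jacobian of [Psi], and [B], [A]
    are transposed since vectors are rows. The formula for [G j] is asked on active [j] only:
    elsewhere the derivative of [C] may enter. *)
Definition linearly_related (I : {set 'I_q}) (G : 'I_q -> 'rV[R]_n -> R)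
    (H : 'rV[R]_n -> 'rV[R]_r) (I' : {set 'I_q}) (G' : 'I_q -> 'rV[R]_n -> R)
    (H' : 'rV[R]_n -> 'rV[R]_r) (M : 'M[R]_n) (s : 'S_q) (c : 'I_q -> R)
    (B : 'M[R]_(r, q)) (A : 'M[R]_r) : Prop :=
  [/\ M \in unitmx /\ A \in unitmx,
      forall j, 0 < c j /\ (s j \in I') = (j \in I),
      forall j v, j \in I ->
        G j v = c j * G' (s j) (v *m M) + (H' (v *m M) *m B) ord0 j &
      forall v, H v = H' (v *m M) *m A].

Context {I I' : {set 'I_q}} {G G' : 'I_q -> 'rV[R]_n -> R}.
Context {H H' : 'rV[R]_n -> 'rV[R]_r}.
Context {M : 'M[R]_n} {s : 'S_q} {c : 'I_q -> R} {B : 'M[R]_(r, q)} {A : 'M[R]_r}.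
Context (rel : linearly_related I G H I' G' H' M s c B A).

(** The system is triangular: invertibility of [A] fixes the value of [H'] first, then the [B] term
    is a known constant and the factor [c j] can be cancelled. *)
Lemma linearly_related_fiber (u : 'I_q -> R) (w : 'rV[R]_r) v :
  ((forall j, j \in I -> G j v = c j * u (s j) + (w *m B) ord0 j) /\
   H v = w *m A) <->
  ((forall j, j \in I' -> G' j (v *m M) = u j) /\ H' (v *m M) = w).
Proof.
have [[uM uA] cs GE HE] := rel.
have hE : H v = w *m A <-> H' (v *m M) = w.
  by rewrite HE; split=> [/(mulmx_unit_inj uA)|->].
split=> -[ug /[dup] /hE hw' hw]; split=> // j jA.
  have [c0 act] := cs (s^-1%g j); rewrite permKV in act.
  have := ug _ (etrans (esym act) jA).
  by rewrite GE -?act // hw' permKV => /addIr /mulfI; apply; exact: lt0r_neq0.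
by rewrite GE // hw ug // (cs j).2.
Qed.

Lemma linearly_related_surj :
  (forall u w, exists v, (forall j, j \in I -> G j v = u j) /\ H v = w) <->
  (forall u w, exists v, (forall j, j \in I' -> G' j v = u j) /\ H' v = w).
Proof.
have [[uM uA] cs _ _] := rel.
split=> surj u w.
  have [v] := surj (fun j => c j * u (s j) + (w *m B) ord0 j) (w *m A).
  by move=> /linearly_related_fiber vP; exists (v *m M).
(* [u'] and [w'] solve [w' *m A = w] and [c j * u' (s j) + (w' *m B) ord0 j = u j]. *)
pose w' := w *m invmx A.
pose u' j := (u (s^-1%g j) - (w' *m B) ord0 (s^-1%g j)) / c (s^-1%g j).
have [v vP] := surj u' w'; exists (v *m invmx M).
have := (linearly_related_fiber u' w' (v *m invmx M)).2.
rewrite mulmxKV // => /(_ vP)[ug hw]; split; last by rewrite hw mulmxKV.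
move=> j jA; rewrite ug // /u' permK mulrC divfK ?subrK //.
by rewrite lt0r_neq0 // (cs j).1.
Qed.

Lemma linearly_related_eq_surj :
  (forall w, exists v, H v = w) <-> (forall w, exists v, H' v = w).
Proof.
have [[uM uA] _ _ HE] := rel; split=> surj w.
  have [v vw] := surj (w *m A); exists (v *m M).
  by apply: (mulmx_unit_inj uA); rewrite -HE.
have [v vw] := surj (w *m invmx A); exists (v *m invmx M).
by rewrite HE mulmxKV // vw mulmxKV.
Qed.

(** On the kernel of [H] the [B] term vanishes, and for active [j] the value [G j v] is a positive
    multiple of [G' (s j) (v *m M)]. The predicate [P] covers both strict signs (MFCQ) and weak
    signs (linearized cone). *)
Lemma linearly_related_kernel (P : R -> bool) v :
  (forall a x, 0 < a -> P (a * x) = P x) ->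
  ((forall j, j \in I -> P (G j v)) /\ H v = 0) <->
  ((forall j, j \in I' -> P (G' j (v *m M))) /\ H' (v *m M) = 0).
Proof.
move=> PM; have [[uM uA] cs GE HE] := rel.
have H0 : H v = 0 <-> H' (v *m M) = 0.
  rewrite HE; split=> [hv|->]; last by rewrite mul0mx.
  by apply: (mulmx_unit_inj uA); rewrite mul0mx.
split=> -[Pg /[dup] /H0 hv' hv]; split=> // j jA.
  have [c0 act] := cs (s^-1%g j); rewrite permKV in act.
  have := Pg _ (etrans (esym act) jA).
  by rewrite GE -?act // hv' mul0mx mxE addr0 permKV PM.
by rewrite GE // hv mul0mx mxE addr0 PM ?(cs j).1 // Pg // (cs j).2.
Qed.

End LinearlyRelated.

(** * Cones, polars and qualifications under a linear change *)

Section Transport.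
Context {R : realType} {n q r : nat}.
Implicit Types (g : 'rV[R]_n -> 'rV[R]_q) (h : 'rV[R]_n -> 'rV[R]_r).

Lemma tangent_cone_image g h g' h' (F : 'rV[R]_n -> 'rV[R]_n) d :
  differentiable F 0 -> F 0 = 0 ->
  (\forall x \near (0 : 'rV[R]_n), feasible g h x -> feasible g' h' (F x)) ->
  tangent_cone g h d -> tangent_cone g' h' ('d F 0 d).
Proof.
move=> dF F0 FM [x [t [xM x0 t0 txd]]].
(* Feasibility of the images holds only near 0, while the cone asks for it at every index; hence the
   shift by [N]. *)
have [N _ FxM] := x0 _ FM.
exists (fun m => F (x (m + N)%N)), (fun m => t (m + N)%N); split => //.
- by move=> m; apply: FxM => //=; exact: leq_addl.
- rewrite -[X in _ --> X]F0; apply: (@cvg_comp _ _ _ (fun m => x (m + N)%N) F _ (nbhs (0 : 'rV[R]_n))).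
    by apply: (cvg_comp _ _ _ x0); exact: cvg_addnr.
  exact: (differentiable_continuous dF).
- apply: (scaled_cvg_image dF F0).
    by apply: (cvg_comp _ _ _ x0); exact: cvg_addnr.
  by apply: (cvg_comp _ _ _ txd); exact: cvg_addnr.
Qed.

(** Right multiplication by [M] is a bijection, so a set is recovered from its preimage. This serves
    ACQ with the Jacobian and GCQ with its inverse transpose. *)
Lemma preimage_mulmx_eq (M : 'M[R]_n) (X Y : set 'rV[R]_n) : M \in unitmx ->
  [set d | X (d *m M)] = [set d | Y (d *m M)] <-> X = Y.
Proof.
move=> uM; split=> [XY|->//]; apply/funext => d.
by rewrite -(mulmxKV uM d); exact: (congr1 (@^~ (d *m invmx M)) XY).
Qed.

Lemma polarE (X : set 'rV[R]_n) :
  polar X = [set v | forall d, X d -> (v *m d^T) ord0 ord0 <= 0].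
Proof.
have dotE (v d : 'rV[R]_n) :
    \sum_(i < n) v ord0 i * d ord0 i = (v *m d^T) ord0 ord0.
  by rewrite mxE; apply: eq_bigr => i _; rewrite mxE.
by apply/funext => v; apply/propext; split=> Xv d /Xv; rewrite dotE.
Qed.

(** The dot product of [v] with [d *m invmx M] is that of [v *m (invmx M)^T] with [d]. *)
Lemma polar_preimage_mulmx (M : 'M[R]_n) (X : set 'rV[R]_n) : M \in unitmx ->
  polar [set d | X (d *m M)] = [set v | polar X (v *m (invmx M)^T)].
Proof.
move=> uM; rewrite !polarE; apply/funext => v; apply/propext.
split=> /= Xv d Xd.
  by rewrite -mulmxA -trmx_mul; apply: Xv; rewrite mulmxKV.
by have := Xv _ Xd; rewrite -mulmxA -trmx_mul mulmxK.
Qed.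

Lemma diff_component g p v j : differentiable g p ->
  'd (component g j) p v = 'd g p v ord0 j.
Proof. by move=> dg; rewrite -diff_entry. Qed.

Lemma diff_active_row g h v : differentiable g 0 -> differentiable h 0 ->
  'd (fun x => row_mx (active_part g x) (h x)) (0 : 'rV[R]_n) v =
  row_mx (\row_k 'd (component g (enum_val k)) (0 : 'rV[R]_n) v)
         ('d h (0 : 'rV[R]_n) v).
Proof.
move=> dg dh; set F := fun x => _.
have FE : (forall k, (fun x => F x ord0 (lshift r k)) = component g (enum_val k)) /\
    (forall k, (fun x => F x ord0 (rshift #|active g| k)) = fun x => h x ord0 k).
  by split=> k; apply/funext => x; rewrite ?row_mxEl ?row_mxEr // mxE.
have dF : differentiable F 0.
  apply: differentiable_rV => j; rewrite -[j]fintype.splitK.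
  by case: (fintype.split j) => k /=; rewrite (FE.1, FE.2); exact: differentiable_entry.
apply/rowP => j; rewrite -diff_entry // -[j]fintype.splitK.
case: (fintype.split j) => k /=; rewrite (FE.1, FE.2) ?row_mxEl ?row_mxEr ?mxE //.
exact: diff_entry.
Qed.

(* Surjectivity does not mention the type 'I_#|active g|, which changes with g. *)
Lemma LICQP g h : differentiable g 0 -> differentiable h 0 ->
  LICQ g h <-> forall (u : 'I_q -> R) (w : 'rV[R]_r), exists v : 'rV[R]_n,
    (forall j, j \in active g -> 'd (component g j) (0 : 'rV[R]_n) v = u j) /\
    'd h (0 : 'rV[R]_n) v = w.
Proof.
move=> dg dh; apply: iff_trans (rank_jacobianP _ _) _; split=> surj.
  move=> u w; have [v] := surj (row_mx (\row_k u (enum_val k)) w).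
  rewrite diff_active_row // => /eq_row_mx[/rowP uv wv]; exists v; split=> // j jA.
  by have := uv (enum_rank_in jA j); rewrite !mxE enum_rankK_in.
move=> w; rewrite -[w]hsubmxK; set a := lsubmx w; set b := rsubmx w.
(* [u] extends [a] from the enumerated active indices by the default 0 on the others. *)
pose u j := if [pick k | enum_val k == j] is Some k then a ord0 k else 0.
have [v [uv wv]] := surj u b; exists v.
rewrite diff_active_row // wv; congr row_mx; apply/rowP => k.
rewrite mxE uv ?enum_valP // /u; case: pickP => [k' /eqP/enum_val_inj -> //|].
by move=> /(_ k); rewrite eqxx.
Qed.

Definition linearly_related_germs g h g' h' M s c B A : Prop :=
  linearly_related
    (active g) (fun j => 'd (component g j) (0 : 'rV[R]_n)) ('d h (0 : 'rV[R]_n))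
    (active g') (fun j => 'd (component g' j) (0 : 'rV[R]_n))
    ('d h' (0 : 'rV[R]_n)) M s c B A.

Section Qualifications.
Context {g g' : 'rV[R]_n -> 'rV[R]_q} {h h' : 'rV[R]_n -> 'rV[R]_r}.
Context {M : 'M[R]_n} {s : 'S_q} {c : 'I_q -> R} {B : 'M[R]_(r, q)} {A : 'M[R]_r}.
Context (rel : linearly_related_germs g h g' h' M s c B A).

Lemma linearly_related_LICQ : differentiable g 0 -> differentiable h 0 ->
  differentiable g' 0 -> differentiable h' 0 -> LICQ g h <-> LICQ g' h'.
Proof.
move=> dg dh dg' dh'; apply: (iff_trans (LICQP dg dh)).
exact: (iff_trans (linearly_related_surj rel) (iff_sym (LICQP dg' dh'))).
Qed.

(** Full rank of [dh] is surjectivity; the strict direction [v] is carried to [v *m M], and back by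
    the inverse of [M]. *)
Lemma linearly_related_MFCQ : MFCQ g h <-> MFCQ g' h'.
Proof.
have [[uM uA] _ _ _] := rel.
have neg (a x : R) : 0 < a -> (a * x < 0) = (x < 0) by move=> /pmulr_rlt0.
have ker := linearly_related_kernel rel _ neg.
have rk : \rank ('J h 0) = r <-> \rank ('J h' 0) = r.
  apply: (iff_trans (rank_jacobianP h 0)).
  exact: (iff_trans (linearly_related_eq_surj rel) (iff_sym (rank_jacobianP h' 0))).
split=> -[rkh [v vP]].
  by split; [exact: rk.1|exists (v *m M); exact: (ker v).1].
split; first exact: rk.2.
by exists (v *m invmx M); apply: (ker _).2; rewrite (mulmxKV uM).
Qed.

Lemma linearly_related_cone :
  linearized_cone g h = [set d | linearized_cone g' h' (d *m M)].
Proof.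
have npos (a x : R) : 0 < a -> (a * x <= 0) = (x <= 0) by move=> /pmulr_rle0.
apply/funext => d; apply/propext.
exact: (linearly_related_kernel rel d npos).
Qed.

End Qualifications.
End Transport.

(** * First-order consequences of the equivalence *)

Section Equivalence.
Context {R : realType} {n q r : nat}.
Implicit Types (g : 'rV[R]_n -> 'rV[R]_q) (h : 'rV[R]_n -> 'rV[R]_r).

Lemma mul_jacobian m (f : 'rV[R]_n -> 'rV[R]_m) p v :
  v *m 'J f p = 'd f p v.
Proof. exact: mul_rV_lin1. Qed.

Lemma pos_monomial_entry (C : 'M[R]_q) : pos_monomial C ->
  exists d : 'I_q -> R, exists s : 'S_q,
    (forall i, 0 < d i) /\ forall i j, C i j = d i *+ (j == s i).
Proof.
move=> [d [s [d0 ->]]]; exists (d ord0), s; split => // i j.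
by rewrite mul_diag_mx !mxE eq_sym mulr_natr.
Qed.

(** For square matrices a one-sided inverse suffices, so only [Phi \o Psi = id] near 0 is
    differentiated. *)
Lemma diffeo_jacobian_unit (Phi Psi : 'rV[R]_n -> 'rV[R]_n) :
  diffeo_germ Phi Psi ->
  cancel ('d Psi (0 : 'rV[R]_n)) ('d Phi (0 : 'rV[R]_n)) /\ 'J Psi 0 \in unitmx.
Proof.
move=> [/smooth_near_differentiable dPhi /smooth_near_differentiable dPsi Phi0 Psi0 inv].
have PsiK : cancel ('d Psi (0 : 'rV[R]_n)) ('d Phi (0 : 'rV[R]_n)).
  have := @diff_cancel R _ _ Psi Phi 0; rewrite Psi0; apply => //.
  by apply: filterS inv => x [].
split => //.
suff JK : 'J Psi 0 *m 'J Phi 0 = 1%:M by exact: (mulmx1_unit JK).1.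
apply/row_matrixP => i; rewrite row_mul rowE (mul_jacobian Psi).
by rewrite (mul_jacobian Phi) PsiK rowE mulmx1.
Qed.

Lemma diff_comp_entry m k (f : 'rV[R]_m -> 'rV[R]_k) (F : 'rV[R]_n -> 'rV[R]_m)
    l v :
  differentiable F 0 -> F 0 = 0 -> differentiable f 0 ->
  differentiable (fun x => f (F x) ord0 l) (0 : 'rV[R]_n) /\
  'd (fun x => f (F x) ord0 l) (0 : 'rV[R]_n) v =
    'd f (0 : 'rV[R]_m) ('d F (0 : 'rV[R]_n) v) ord0 l.
Proof.
move=> dF F0 df.
have dfF : differentiable (f \o F) 0.
  by apply: differentiable_comp => //; rewrite F0.
split; first exact: differentiable_entry dfF.
rewrite (diff_entry v ord0 l dfF) diff_comp ?F0 //.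
Qed.

(** [h x] and [h' y] vanish together as [A] is invertible; then the [B] term disappears and each
    inequality constraint at [x] is a positive multiple of the one at [y] selected by [s]. *)
Lemma feasible_transform (C : 'M[R]_q) (B : 'M[R]_(q, r)) (A : 'M[R]_r)
    g h g' h' x y :
  pos_monomial C -> A \in unitmx ->
  (g x)^T = C *m (g' y)^T + B *m (h' y)^T -> (h x)^T = A *m (h' y)^T ->
  feasible g h x <-> feasible g' h' y.
Proof.
move=> /pos_monomial_entry[d [s [d0 CE]]] uA gE hE.
have hz : h x = 0 <-> h' y = 0.
  split=> hy; apply: trmx_inj; rewrite trmx0.
    by rewrite -(mulKmx uA (h' y)^T) -hE hy trmx0 mulmx0.
  by rewrite hE hy trmx0 mulmx0.
have gz i : h' y = 0 -> component g i x = d i * component g' (s i) y.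
  move=> hy; have := congr1 (fun X : 'cV_q => X i ord0) gE.
  rewrite /component hy trmx0 mulmx0 addr0 !mxE => ->.
  rewrite (bigD1 (s i)) //= big1.
    by rewrite CE eqxx mxE addr0.
  by move=> j /negPf js; rewrite CE js mul0r.
split=> -[gle /[dup] /hz hz' hz0]; split => // i.
  have := gle (s^-1%g i); rewrite gz // permKV pmulr_rle0 //.
by rewrite gz // pmulr_rle0.
Qed.

Lemma KG_feasible g h g' h' (Psi : 'rV[R]_n -> 'rV[R]_n)
    (C : 'rV[R]_n -> 'M[R]_q) (B : 'rV[R]_n -> 'M[R]_(q, r))
    (A : 'rV[R]_n -> 'M[R]_r) :
  (\forall x \near (0 : 'rV[R]_n), pos_monomial (C x) /\ A x \in unitmx) ->
  (\forall x \near (0 : 'rV[R]_n),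
          (g x)^T = C x *m (g' (Psi x))^T + B x *m (h' (Psi x))^T /\
          (h x)^T = A x *m (h' (Psi x))^T) ->
  \forall x \near (0 : 'rV[R]_n), feasible g h x <-> feasible g' h' (Psi x).
Proof.
by apply: filterS2 => x [Cx Ax] [gx hx]; exact: feasible_transform gx hx.
Qed.

Lemma diffeo_tangent_cone g h g' h' (Phi Psi : 'rV[R]_n -> 'rV[R]_n) :
  diffeo_germ Phi Psi ->
  (\forall x \near (0 : 'rV[R]_n), feasible g h x <-> feasible g' h' (Psi x)) ->
  tangent_cone g h = [set d | tangent_cone g' h' (d *m 'J Psi 0)].
Proof.
move=> diffeo feas; have [PsiK _] := diffeo_jacobian_unit diffeo.
case: diffeo => /smooth_near_differentiable dPhi /smooth_near_differentiable dPsi.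
move=> Phi0 Psi0 inv.
apply/funext => d; apply/propext => /=; rewrite mul_jacobian; split.
  by apply: tangent_cone_image => //; apply: filterS feas => x [].
(* Writing [d] as the image under ['d Phi 0] of ['d Psi 0 d] reduces the converse to pushing the
   cone forward along [Phi]. *)
rewrite -[X in _ -> tangent_cone g h X]PsiK.
apply: tangent_cone_image => //.
(* Continuity of [Phi] at its fixed point 0 transports the equivalence to the points [Phi y]. *)
have feasPhi : \forall y \near (0 : 'rV[R]_n),
    feasible g h (Phi y) <-> feasible g' h' (Psi (Phi y)).
  have cPhi : Phi y @[y --> (0 : 'rV[R]_n)] --> (0 : 'rV[R]_n).
    by rewrite -[X in _ --> X]Phi0; exact: (differentiable_continuous dPhi).
  exact: (cPhi _ feas).
by apply: filterS2 inv feasPhi => y [_ ->] [].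
Qed.

(** Each coordinate identity is a sum of products whose second factors vanish at 0, so its
    differential involves the coefficients at 0 only. For [g'] this vanishing is where activity
    enters. *)
Lemma KG_linearly_related g h g' h' (Phi Psi : 'rV[R]_n -> 'rV[R]_n)
    (C : 'rV[R]_n -> 'M[R]_q) (B : 'rV[R]_n -> 'M[R]_(q, r))
    (A : 'rV[R]_n -> 'M[R]_r) :
  constraint_germ g h -> constraint_germ g' h' -> diffeo_germ Phi Psi ->
  smooth_near C 0 -> smooth_near B 0 -> smooth_near A 0 ->
  (\forall x \near (0 : 'rV[R]_n), pos_monomial (C x) /\ A x \in unitmx) ->
  (\forall x \near (0 : 'rV[R]_n),
          (g x)^T = C x *m (g' (Psi x))^T + B x *m (h' (Psi x))^T /\
          (h x)^T = A x *m (h' (Psi x))^T) ->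
  exists (s : 'S_q) c, linearly_related_germs g h g' h' ('J Psi 0) s c (B 0)^T (A 0)^T.
Proof.
move=> [/smooth_near_differentiable dg /smooth_near_differentiable dh h0].
move=> [/smooth_near_differentiable dg' /smooth_near_differentiable dh' h'0].
move=> diffeo; have [_ uPsi] := diffeo_jacobian_unit diffeo.
case: diffeo => [_ /smooth_near_differentiable dPsi _ Psi0 _].
move=> /smooth_near_differentiable dC /smooth_near_differentiable dB.
move=> /smooth_near_differentiable dA CA eqs.
have [/pos_monomial_entry[c [s [c0 CE]]] uA] := nbhs_singleton CA.
have dh'Psi l v := diff_comp_entry l v dPsi Psi0 dh'.
have dg'Psi l v := diff_comp_entry l v dPsi Psi0 dg'.
(* The permutation is locally constant: by continuity the entry (i, s i)
   stays positive near 0. *)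
have gE i : \forall x \near (0 : 'rV[R]_n), component g i x =
    C x i (s i) * g' (Psi x) ord0 (s i) + \sum_l B x i l * h' (Psi x) ord0 l.
  have Cpos : \forall x \near (0 : 'rV[R]_n), 0 < C x i (s i).
    have := differentiable_continuous (differentiable_entry i (s i) dC).
    by move=> /(cvgr_gt (C 0 i (s i))); apply; rewrite CE eqxx c0.
  near=> x.
  have : 0 < C x i (s i) by near: x.
  have [+ _] : pos_monomial (C x) /\ A x \in unitmx by near: x.
  move=> /pos_monomial_entry[d [s' [_ CxE]]].
  have [gx _] : (g x)^T = C x *m (g' (Psi x))^T + B x *m (h' (Psi x))^T /\
          (h x)^T = A x *m (h' (Psi x))^T by near: x.
  (* Row [i] of [C x] is zero outside column [s' i], so positivity at column [s i] forces
     [s' i = s i]. *)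
  rewrite CxE; case: eqP => [ss' _|_]; last by rewrite ltxx.
  have := congr1 (fun X : 'cV_q => X i ord0) gx; rewrite !mxE => gxi.
  rewrite /component gxi; congr (_ + _); last by apply: eq_bigr => l _; rewrite mxE.
  rewrite (bigD1 (s i)) //= big1 ?addr0; first by rewrite CxE ss' eqxx mxE.
  by move=> j; rewrite ss' => /negPf js; rewrite CxE js mul0r.
have hE k : \forall x \near (0 : 'rV[R]_n), h x ord0 k =
    \sum_l A x k l * h' (Psi x) ord0 l.
  apply: filterS eqs => x [_ /(congr1 (fun X : 'cV_r => X k ord0))].
  by rewrite !mxE => ->; apply: eq_bigr => l _; rewrite mxE.
(* At 0 the inequality constraints themselves are related by the positive factor [c i], so [s]
   matches the active indices. *)
have actE i : component g i 0 = c i * component g' (s i) 0.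
  rewrite (nbhs_singleton (gE i)) Psi0 h'0 CE eqxx big1 ?addr0 // => l _.
  by rewrite mxE mulr0.
exists s, c; split.
- by rewrite uPsi unitmx_tr.
- by move=> i; rewrite !inE actE mulf_eq0 (gt_eqF (c0 i)).
- move=> i v; rewrite inE actE mulf_eq0 (gt_eqF (c0 i)) orFb => /eqP g'0.
  have dCu : differentiable (fun x => C x i (s i) * g' (Psi x) ord0 (s i)) (0 : 'rV[R]_n).
    apply: differentiableM; [exact: differentiable_entry|exact: (dg'Psi _ 0).1].
  have dBu : differentiable (fun x => \sum_l B x i l * h' (Psi x) ord0 l) (0 : 'rV[R]_n).
    by apply: differentiable_sum_mul => l;
      [exact: differentiable_entry|exact: (dh'Psi _ 0).1].
  rewrite (diff_near_eq v _ _ (gE i)).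
  + rewrite diffD //= diff_mul0; first last.
    * by rewrite Psi0.
    * exact: (dg'Psi _ 0).1.
    * exact: differentiable_entry.
    rewrite diff_sum_mul0; first last.
    * by move=> l; rewrite Psi0 h'0 mxE.
    * by move=> l; exact: (dh'Psi _ 0).1.
    * by move=> l; exact: differentiable_entry.
    rewrite CE eqxx (dg'Psi _ v).2 mul_jacobian diff_component // mxE.
    congr (_ + _); apply: eq_bigr => l _.
    by rewrite (dh'Psi _ v).2 mxE mulrC.
  + exact: differentiable_entry.
  + exact: differentiableD.
- move=> v; apply/rowP => k; rewrite -diff_entry // (diff_near_eq v _ _ (hE k)).
  + rewrite diff_sum_mul0; first last.
    * by move=> l; rewrite Psi0 h'0 mxE.
    * by move=> l; exact: (dh'Psi _ 0).1.
    * by move=> l; exact: differentiable_entry.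
    rewrite mul_jacobian mxE; apply: eq_bigr => l _.
    by rewrite (dh'Psi _ v).2 mxE mulrC.
  + exact: differentiable_entry.
  + by apply: differentiable_sum_mul => l;
      [exact: differentiable_entry|exact: (dh'Psi _ 0).1].
Unshelve. all: by end_near. Qed.

End Equivalence.

Theorem theorem3p1 (R : realType) (n q r : nat)
  (g : 'rV[R]_n -> 'rV[R]_q) (h : 'rV[R]_n -> 'rV[R]_r)
  (g' : 'rV[R]_n -> 'rV[R]_q) (h' : 'rV[R]_n -> 'rV[R]_r)
  (gh_germ : constraint_germ g h) (gh'_germ : constraint_germ g' h')
  (gh_nonempty : nonempty_germ (feasible g h))
  (gh'_nonempty : nonempty_germ (feasible g' h'))
  (equiv : KG_equivalent g h g' h') :
  [/\ LICQ g h <-> LICQ g' h',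
      MFCQ g h <-> MFCQ g' h',
      ACQ g h <-> ACQ g' h' &
      GCQ g h <-> GCQ g' h'].
Proof.
have [Phi [Psi [C [B [A [diffeo [sC sB sA] CA eqs]]]]]] := equiv.
have [s [c rel]] := KG_linearly_related gh_germ gh'_germ diffeo sC sB sA CA eqs.
have [_ uPsi] := diffeo_jacobian_unit diffeo.
have CE := diffeo_tangent_cone diffeo (KG_feasible CA eqs).
have LE := linearly_related_cone rel.
have [/smooth_near_differentiable dg /smooth_near_differentiable dh _] := gh_germ.
have [/smooth_near_differentiable dg' /smooth_near_differentiable dh' _] := gh'_germ.
split.
- exact: (linearly_related_LICQ rel).
- exact: (linearly_related_MFCQ rel).
- by rewrite /ACQ CE LE; exact: preimage_mulmx_eq.
(* Polarity turns both preimages under the Jacobian into preimages under its inverse transpose,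
   again invertible. *)
- rewrite /GCQ CE LE !polar_preimage_mulmx //; apply: preimage_mulmx_eq.
  by rewrite unitmx_tr unitmx_inv.
Qed.
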